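(* Let $\tau\in\mathfrak S_k$, and let $B$ be a bivincular pattern of length $k$. If $\mathrm{Box}(\tau)$ and $B$ are coincident, then $k\le4$. In particular, boxed--bivincular coincidences do not occur in arbitrarily large lengths.
   Context: $\mathfrak S_n$ is the set of permutations $\pi=\pi_1\cdots\pi_n$ of $\{1,\dots,n\}$. For $\tau\in\mathfrak S_k$, an occurrence of the boxed pattern $\mathrm{Box}(\tau)$ in $\pi\in\mathfrak S_n$ is a choice of positions $i_1<\cdots<i_k$ such that $\pi_{i_1}\cdots\pi_{i_k}$ is order-isomorphic to $\tau$ and there is no index $j\notin\{i_1,\dots,i_k\}$ with $i_1<j<i_k$ and $\min_r \pi_{i_r}<\pi_j<\max_r\pi_{i_r}$. A bivincular pattern of length $k$ is a triple $(\sigma,X,Y)$ with $\sigma\in\mathfrak S_k$ and $X,Y\subseteq\{1,\dots,k-1\}$ (possibly empty); an occurrence of it in $\pi$ is a choice of positions $i_1<\cdots<i_k$ such that $\pi_{i_1}\cdots\pi_{i_k}$ is order-isomorphic to $\sigma$, $i_{x+1}=i_x+1$ for every $x\in X$, and, if $v_1<\cdots<v_k$ are the selected values in increasing order, $v_{y+1}=v_y+1$ for every $y\in Y$. $\mathrm{Av}_n(P)$ is the set of permutations in $\mathfrak S_n$ with no occurrence of $P$. Patterns $P,Q$ are coincident if $\mathrm{Av}_n(P)=\mathrm{Av}_n(Q)$ for every $n\ge0$. *)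

(* Defs.v *)
From mathcomp Require Import all_boot all_fingroup.
Set Implicit Arguments. Unset Strict Implicit. Unset Printing Implicit Defensive.

(* Positions and values are 0-based: 'I_n stands for {1, ..., n}. *)

(* A pattern of length k is given by its occurrences: [P n pi p] says that the
   positions listed in p form an occurrence of P in pi. *)
Definition pattern (k : nat) : Type := forall n : nat, 'S_n -> k.-tuple 'I_n -> bool.

Definition positions (n k : nat) (p : k.-tuple 'I_n) : seq nat :=
  [seq nat_of_ord i | i <- p].

Definition values (n k : nat) (pi : 'S_n) (p : k.-tuple 'I_n) : seq nat :=
  sort leq [seq nat_of_ord (pi i) | i <- p].

Definition classical_occ (k : nat) (tau : 'S_k) : pattern k := fun n pi p =>
  sorted ltn (positions p) &&
  [forall a : 'I_k, forall b : 'I_k,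
     (pi (tnth p a) < pi (tnth p b)) == (tau a < tau b)].

(* The defaults n (for the first position and for the minimum) and 0 (for the
   last position and for the maximum) matter only when k = 0, in which case no
   j satisfies the bounds; for k > 0 they do not affect the result. *)
Definition Box (k : nat) (tau : 'S_k) : pattern k := fun n pi p =>
  classical_occ tau pi p &&
  ~~ [exists j : 'I_n,
        [&& j \notin p,
            head n (positions p) < j < last 0 (positions p) &
            \big[minn/n]_(i <- p) pi i < pi j < \max_(i <- p) pi i]].

(* In bv_X and bv_Y, the element x : 'I_k.-1 stands for the index x + 1 of
   {1, ..., k - 1}: it ties the entries of 0-based ranks x and x + 1. *)
Record bivincular (k : nat) : Type := Bivincular {
  bv_perm : 'S_k;
  bv_X : {set 'I_k.-1};
  bv_Y : {set 'I_k.-1} }.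

Definition Biv (k : nat) (B : bivincular k) : pattern k := fun n pi p =>
  [&& classical_occ (bv_perm B) pi p,
      [forall x in bv_X B,
         nth 0 (positions p) x.+1 == (nth 0 (positions p) x).+1] &
      [forall y in bv_Y B,
         nth 0 (values pi p) y.+1 == (nth 0 (values pi p) y).+1]].

Definition Av (k : nat) (P : pattern k) (n : nat) : {set 'S_n} :=
  [set pi : 'S_n | ~~ [exists p : k.-tuple 'I_n, P n pi p]].

Definition coincident (k l : nat) (P : pattern k) (Q : pattern l) : Prop :=
  forall n : nat, Av P n = Av Q n.

(* Main.v *)
Require Import Defs.
From mathcomp Require Import all_boot all_fingroup.
From mathcomp Require Import zify.
Set Implicit Arguments. Unset Strict Implicit. Unset Printing Implicit Defensive.

(** Draw [tau : 'S_k] as k points in a square, cut by the lines through the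
    points into k + 1 columns and k + 1 rows of cells, numbered from 0.  The
    permutation [lift_perm i j tau] inserts one new point in the cell in
    column i and row j.  Lengths k and k + 1 alone already force k <= 4.

    In length k only [tau] contains Box(tau) and only [sigma] contains
    (sigma, X, Y), so [sigma = tau] ([coincident_perm]).  In length k + 1 an
    occurrence leaves out exactly one position, so a permutation contains the
    boxed pattern iff it is an insertion into a cell on the border of the grid,
    and the bivincular one iff it is an insertion into a cell whose column is
    not in X and whose row is not in Y ([contains_Box], [contains_Biv]).
    Coincidence therefore says that the border cells and the unshaded cells
    give the same insertions.

    Two different cells give the same insertion only if they are the ends of
    a run of points of [tau] with consecutive positions and consecutive
    values, increasing or decreasing ([chain_right], [chain_left]).  This has
    two consequences.

    - For x in X, the insertions at the bottom and at the top of column x must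
      arise from other columns, so the smallest and the largest entries of
      [tau] are exactly the two neighbours of column x.  Hence X has at most
      one element, and so has Y, by passing to the inverse permutation
      ([tied_column_touches_extremes], [tied_column_unique]).

    - An interior cell that is not shaded is joined to the border by a run,
      hence touches one of the two neighbouring points of its column.  Suppose
      that an unshaded interior column has an extreme entry on one side and an
      entry v on the other.  It has at least k - 2 >= 3 unshaded interior
      rows when k >= 5; the extreme entry accounts for one of them only, so
      both cells touching v are joined to the border through v.  One of them
      needs a run that rises from v, the other a run that falls, which is
      possible only if v is the first or the last entry of [tau]
      ([column_beside_extreme]).

    So each extreme entry is within distance 1 of either end of [tau], except
    on a side where its neighbour is the other extreme entry, across the single
    column of X.  The smallest and the largest entry cannot both satisfy this
    when k >= 5 ([no_balanced_shading]). *)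

(** * Occurrences that omit a single position *)

Definition contains (k : nat) (P : pattern k) (n : nat) (pi : 'S_n) : bool :=
  [exists p : k.-tuple 'I_n, P n pi p].

Lemma coincident_contains (k l : nat) (P : pattern k) (Q : pattern l) :
  coincident P Q -> forall (n : nat) (pi : 'S_n), contains P pi = contains Q pi.
Proof.
move=> PQ n pi; apply: negb_inj.
by have /setP/(_ pi) := PQ n; rewrite !inE.
Qed.

(** The value at a position is the number of positions with smaller values. *)
Lemma perm_order_inj (k : nat) (s t : 'S_k) :
  (forall a b, (s a < s b) = (t a < t b)) -> s = t.
Proof.
have rank (u : 'S_k) (a : 'I_k) : #|[set b | u b < u a]| = u a :> nat.
  have -> : [set b | u b < u a] = u @^-1: [set c : 'I_k | c < u a].
    by apply/setP=> b; rewrite !inE.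
  rewrite on_card_preimset; last first.
    by exists (u^-1)%g => x _; rewrite ?permK ?permKV.
  rewrite cardsE -sum1_card -(big_ord_widen_cond k xpredT (fun=> 1)) ?sum1_card ?card_ord //.
  exact: ltnW.
move=> st; apply/permP=> a; apply: val_inj; rewrite /= -(rank s) -(rank t).
by apply: eq_card => b; rewrite !inE st.
Qed.

Definition omit (k : nat) (i : 'I_k.+1) : k.-tuple 'I_k.+1 :=
  [tuple lift i a | a < k].

Lemma positions_omit (k : nat) (i : 'I_k.+1) :
  positions (omit i) = [seq bump i a | a <- iota 0 k].
Proof. by rewrite /positions -map_comp -val_enum_ord -map_comp. Qed.

Lemma sorted_bump (h k : nat) : sorted ltn [seq bump h a | a <- iota 0 k].
Proof.
rewrite (homo_sorted (e := ltn)) ?iota_ltn_sorted // => a b.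
by rewrite /bump; lia.
Qed.

Lemma positions_inj (n k : nat) : injective (@positions n k).
Proof. by move=> p q /inj_map pq; apply/val_inj/pq/val_inj. Qed.

Lemma mem_omit (k : nat) (i j : 'I_k.+1) : (j \in omit i) = (j != i).
Proof.
apply/tnthP/idP => [[a ->]|]; first by rewrite tnth_mktuple eq_sym neq_lift.
rewrite eq_sym => ji; have [a -> _] := unlift_some ji.
by exists a; rewrite tnth_mktuple.
Qed.

Lemma sorted_omit (k : nat) (p : k.-tuple 'I_k.+1) :
  sorted ltn (positions p) -> exists i, p = omit i.
Proof.
move=> p_sorted.
(* There are more positions than entries of [p]. *)
have [i ip] : exists i, i \notin p.
  apply/existsP; rewrite -negb_forall; apply/negP => /forallP all_p.
  have := card_size p; rewrite size_tuple (eq_card (B := 'I_k.+1)) ?card_ord ?ltnn //.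
have p_uniq : uniq p.
  by rewrite -(map_inj_uniq val_inj) (sorted_uniq ltn_trans ltnn).
exists i; apply: positions_inj.
apply: (irr_sorted_eq ltn_trans ltnn) => //.
  by rewrite positions_omit sorted_bump.
apply: eq_mem_map.
have sub : {subset p <= omit i}.
  by move=> j jp; rewrite mem_omit; apply: contraNneq ip => <-.
have [//|_ //] := uniq_min_size p_uniq sub.
by rewrite !size_tuple.
Qed.

(** The value at the omitted position [i] fixes the row of the cell; the
    other entries are then determined by their relative order. *)
Lemma classical_occ_omit (k : nat) (tau : 'S_k) (pi : 'S_k.+1) (i : 'I_k.+1) :
  classical_occ tau pi (omit i) = (pi == lift_perm i (pi i) tau).
Proof.
rewrite /classical_occ positions_omit sorted_bump /=.
apply/forallP/eqP => [occ|-> a]; last first.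
  apply/forallP=> b; rewrite !tnth_mktuple !lift_perm_lift /=.
  by apply/eqP; rewrite /bump; lia.
have pi_lift a : exists b, pi (lift i a) = lift (pi i) b.
  have : pi i != pi (lift i a) by rewrite (inj_eq perm_inj) neq_lift.
  by move=> /unlift_some[b -> _]; exists b.
pose f a := odflt a (unlift (pi i) (pi (lift i a))).
have fE a : pi (lift i a) = lift (pi i) (f a).
  by rewrite /f; have [b ->] := pi_lift a; rewrite liftK.
have f_inj : injective f.
  by move=> a b ab; apply/(@lift_inj _ i)/(@perm_inj _ pi); rewrite !fE ab.
have <- : perm f_inj = tau.
  apply: perm_order_inj => a b; rewrite !permE.
  have /forallP/(_ b)/eqP <- := occ a.
  by rewrite !tnth_mktuple !fE /= /bump; lia.
apply/permP=> u; have [a ->|->] := unliftP i u; last by rewrite lift_perm_id.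
by rewrite lift_perm_lift permE fE.
Qed.

(** * The cells allowed by each pattern *)

(** Insertions into [tau] in different cells may coincide, and one allowed
    cell is enough for an occurrence: hence the existential quantifier. *)
Lemma contains_succ (k : nat) (P : pattern k) (tau : 'S_k) (c : rel nat) :
    (forall n (pi : 'S_n) p, P n pi p -> classical_occ tau pi p) ->
    (forall i j, P k.+1 (lift_perm i j tau) (omit i) = c i j) ->
  forall pi : 'S_k.+1,
    contains P pi <-> exists i j : 'I_k.+1, c i j /\ pi = lift_perm i j tau.
Proof.
move=> P_occ Pc pi; split=> [/existsP[p Pp]|[i [j [cij ->]]]]; last first.
  by apply/existsP; exists (omit i); rewrite Pc.
have occ := P_occ _ _ _ Pp; have /andP[/sorted_omit[i pE] _] := occ.
move: Pp occ; rewrite pE classical_occ_omit => Pp /eqP piE.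
by exists i, (pi i); rewrite -Pc -piE.
Qed.

Lemma bigminn_le (I : eqType) (n : nat) (s : seq I) (F : I -> nat) (x : I) :
  x \in s -> \big[minn/n]_(i <- s) F i <= F x.
Proof.
elim: s => // y s IH; rewrite inE big_cons => /orP[/eqP <-|/IH]; lia.
Qed.

Definition boundary (k i j : nat) : bool :=
  [|| i == 0, i == k, j == 0 | j == k].

Lemma Box_omit (k : nat) (tau : 'S_k) (i j : 'I_k.+1) : 1 < k ->
  Box tau (lift_perm i j tau) (omit i) = boundary k i j.
Proof.
move=> k_gt1; set pi := lift_perm i j tau.
have pi_i : pi i = j by rewrite /pi lift_perm_id.
rewrite /Box classical_occ_omit pi_i eqxx /=.
have k_gt0 := ltnW k_gt1.
have hdE : head k.+1 (positions (omit i)) = bump i 0.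
  by rewrite positions_omit -nth0 (nth_map 0) ?size_iota ?nth_iota.
have lastE : last 0 (positions (omit i)) = bump i k.-1.
  rewrite positions_omit -nth_last size_map size_iota.
  by rewrite (nth_map 0) ?size_iota ?nth_iota ?prednK.
rewrite hdE lastE.
have pi_hit (b : 'I_k.+1) : b != j -> exists2 u, u \in omit i & pi u = b.
  move=> bj; exists ((pi^-1)%g b); rewrite ?permKV // mem_omit.
  by apply: contraNneq bj => ib; rewrite -pi_i -ib permKV.
apply/negP/idP => [no_box|bd].
  apply: contra_notT no_box; rewrite !negb_or => /and4P[i0 ik j0 jk].
  apply/existsP; exists i; rewrite mem_omit eqxx pi_i /=.
  have [u u_in pi_u] := pi_hit ord0 ltac:(by rewrite -val_eqE eq_sym).
  have [v v_in pi_v] := pi_hit ord_max ltac:(by rewrite -val_eqE eq_sym).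
  apply/and3P; split; first by rewrite /bump; have := ltn_ord i; lia.
    by apply: leq_ltn_trans (bigminn_le _ _ u_in) _; rewrite pi_u lt0n.
  apply: leq_trans (leq_bigmax_seq v v_in erefl); rewrite pi_v /=.
  by have := ltn_ord j; lia.
case/existsP=> u; rewrite mem_omit negbK => /and3P[/eqP -> i_in].
rewrite pi_i => /andP[/(leq_ltn_trans (leq0n _)) j_gt0 j_lt_max].
have j_lt : j < k.
  apply: leq_trans j_lt_max _.
  by apply/bigmax_leqP_seq => v _ _; rewrite -ltnS.
by move: bd i_in j_gt0 j_lt (ltn_ord i); rewrite /boundary /bump; lia.
Qed.

(** The line that [x : 'I_k.-1] stands for ties the entries of ranks x and
    x + 1; the cells between them have index x + 1. *)
Definition separates (k : nat) (X : {set 'I_k.-1}) (i : nat) : bool :=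
  [exists x in X, i == x.+1].

Lemma values_omit (k : nat) (tau : 'S_k) (i j : 'I_k.+1) :
  values (lift_perm i j tau) (omit i) = [seq bump j b | b <- iota 0 k].
Proof.
rewrite /values; apply: (sorted_eq leq_trans anti_leq).
- exact: sort_sorted leq_total _.
- by apply: sub_sorted (sorted_bump j k) => a b /ltnW.
rewrite perm_sort -val_enum_ord.
have -> : [seq nat_of_ord (lift_perm i j tau u) | u <- omit i]
    = [seq bump j b | b <- [seq val b | b <- [seq tau a | a <- enum 'I_k]]].
  by rewrite -!map_comp; apply: eq_map => a /=; rewrite lift_perm_lift.
apply: perm_map; apply: perm_map.
apply: uniq_perm; rewrite ?(map_inj_uniq perm_inj) ?enum_uniq // => b.
by rewrite mem_enum -[b](permKV tau) map_f ?mem_enum.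
Qed.

Lemma adjacent_bump (k : nat) (X : {set 'I_k.-1}) (h : nat) (s := [seq bump h a | a <- iota 0 k]) :
  [forall x in X, nth 0 s x.+1 == (nth 0 s x).+1] = ~~ separates X h.
Proof.
rewrite /separates negb_exists; apply: eq_forallb => x.
rewrite negb_and -implybE; congr (_ ==> _).
have := ltn_ord x; rewrite -ltnS; case: k X x @s => [|k] X x s /= x_lt; first by case: x x_lt.
rewrite /s !(nth_map 0) ?size_iota ?nth_iota //; try lia.
rewrite /bump; lia.
Qed.

Lemma Biv_omit (k : nat) (B : bivincular k) (i j : 'I_k.+1) :
  Biv B (lift_perm i j (bv_perm B)) (omit i) =
  ~~ separates (bv_X B) i && ~~ separates (bv_Y B) j.
Proof.
rewrite /Biv classical_occ_omit lift_perm_id eqxx positions_omit values_omit.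
by rewrite !adjacent_bump.
Qed.

Lemma contains_Box (k : nat) (tau : 'S_k) (pi : 'S_k.+1) : 1 < k ->
  contains (Box tau) pi <->
  exists i j : 'I_k.+1, boundary k i j /\ pi = lift_perm i j tau.
Proof.
move=> k_gt1; apply: (contains_succ (P := Box tau)) => [m rho p /andP[]|i j] //.
exact: Box_omit.
Qed.

Lemma contains_Biv (k : nat) (B : bivincular k) (pi : 'S_k.+1) :
  contains (Biv B) pi <->
  exists i j : 'I_k.+1, ~~ separates (bv_X B) i && ~~ separates (bv_Y B) j
    /\ pi = lift_perm i j (bv_perm B).
Proof.
apply: (contains_succ (P := Biv B) (tau := bv_perm B)
  (c := fun i j => ~~ separates (bv_X B) i && ~~ separates (bv_Y B) j)).
  by move=> m rho p /and3P[].
exact: Biv_omit.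
Qed.

(** * Length k: the underlying permutations agree *)

Lemma sorted_ord_tuple (k : nat) (p : k.-tuple 'I_k) :
  sorted ltn (positions p) -> p = ord_tuple k.
Proof.
move=> p_sorted; apply: positions_inj.
apply: (irr_sorted_eq ltn_trans ltnn) => //.
  by rewrite /positions val_enum_ord iota_ltn_sorted.
have p_uniq : uniq p.
  by rewrite -(map_inj_uniq val_inj) (sorted_uniq ltn_trans ltnn).
apply: eq_mem_map => j; rewrite mem_enum inE.
have sub : {subset p <= enum 'I_k} by move=> x _; rewrite mem_enum.
have [|_ ->] := uniq_min_size p_uniq sub; last by rewrite mem_enum.
by rewrite (size_tuple p) size_enum_ord.
Qed.

Lemma coincident_perm (k : nat) (tau : 'S_k) (B : bivincular k) :
  coincident (Box tau) (Biv B) -> bv_perm B = tau.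
Proof.
move=> /coincident_contains/(_ k tau) box_biv.
have : contains (Box tau) tau.
  apply/existsP; exists (ord_tuple k); apply/andP; split.
    rewrite /classical_occ /positions val_enum_ord iota_ltn_sorted.
    by apply/'forall_forallP=> a b; rewrite !tnth_ord_tuple.
  by apply/existsP=> -[j]; rewrite mem_enum.
rewrite box_biv => /existsP[p /and3P[/andP[/sorted_ord_tuple -> /'forall_forallP occ] _ _]].
by apply: perm_order_inj => a b; have /eqP := occ a b; rewrite !tnth_ord_tuple.
Qed.

(** * Cells with equal insertions *)

(** What remains visible, near a cell of row [j], of a run that joins it to
    the border: [v] is the entry beside the cell, [w] the one after it in the
    direction of the run, and [last] says that there is none.  The run rises
    from [v = j] or falls from [v = j - 1]; it either stops at [v], having
    reached the border sideways, at the top or at the bottom, or goes on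
    through [w]. *)
Definition chain (k v w : nat) (last : bool) (j : nat) : bool :=
  (v == j) && [|| last, j.+1 == k | w == j.+1] ||
  (v.+1 == j) && [|| last, j == 1 | w.+1 == v].

(** One-line notation with plain numbers as positions, so that the positions
    next to a given one are available to arithmetic. *)
Definition entry (n : nat) (s : 'S_n.+1) (a : nat) : nat := s (inord a).

Lemma entry_ltn (n : nat) (s : 'S_n.+1) (a : nat) : entry s a < n.+1.
Proof. exact: ltn_ord. Qed.

Lemma entry_inj (n : nat) (s : 'S_n.+1) (a b : nat) :
  a < n.+1 -> b < n.+1 -> entry s a = entry s b -> a = b.
Proof.
by move=> a_lt b_lt /val_inj/perm_inj/(congr1 val); rewrite /= !inordK.
Qed.

Lemma entry_lift_id (n : nat) (tau : 'S_n.+1) (i j : 'I_n.+2) :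
  entry (lift_perm i j tau) i = j.
Proof. by rewrite /entry inord_val lift_perm_id. Qed.

Lemma entry_lift (n : nat) (tau : 'S_n.+1) (i j : 'I_n.+2) (a u : nat) :
  a < n.+1 -> u = bump i a ->
  entry (lift_perm i j tau) u = bump j (entry tau a).
Proof.
move=> a_lt ->; rewrite /entry.
have -> : inord (bump i a) = lift i (inord a : 'I_n.+1).
  apply: val_inj; rewrite /= !inordK //.
  by rewrite /bump; lia.
by rewrite lift_perm_lift.
Qed.

Section EqualInsertions.

Variables (n : nat) (tau : 'S_n.+1) (i j i' j' : 'I_n.+2).
Hypothesis eq_lift : lift_perm i j tau = lift_perm i' j' tau.

Let entry_at_i a : a < n.+1 -> val i = bump i' a -> val j = bump j' (entry tau a).
Proof. by move=> a_lt /(entry_lift tau j' a_lt) <-; rewrite -eq_lift entry_lift_id. Qed.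

Let entry_at_i' a : a < n.+1 -> val i' = bump i a -> val j' = bump j (entry tau a).
Proof. by move=> a_lt /(entry_lift tau j a_lt) <-; rewrite eq_lift entry_lift_id. Qed.

Let entry_shift a b : a < n.+1 -> b < n.+1 -> bump i a = bump i' b ->
  bump j (entry tau a) = bump j' (entry tau b).
Proof.
move=> a_lt b_lt ab.
by rewrite -(entry_lift (i := i) tau j a_lt erefl) eq_lift (entry_lift tau _ b_lt ab).
Qed.

(** At the position of one of the two inserted points, the other description
    of the permutation shows an entry of [tau], which must lie beside it. *)
Lemma equal_insertion_touches : i != i' ->
  exists2 a : nat, (a == i) || (a.+1 == i) & a < n.+1 /\
    ((entry tau a == j) || ((entry tau a).+1 == j)).
Proof.
have i_lt := ltn_ord i; have i'_lt := ltn_ord i'.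
rewrite -val_eqE /= neq_ltn => /orP[lt_ii'|lt_i'i].
  have a_lt : i < n.+1 by lia.
  exists i; rewrite ?eqxx //; split=> //.
  have /= := entry_at_i a_lt; rewrite {1 2}/bump => ->; rewrite /bump; lia.
have a_lt : i.-1 < n.+1 by lia.
exists i.-1; first by lia.
by split=> //; have /= -> := entry_at_i a_lt; rewrite /bump; lia.
Qed.

(** Between the two inserted points, each entry of the permutation is read
    once as the entry of [tau] at the same position and once as the entry
    before it.  Hence neighbouring entries of [tau] differ by one, always in
    the direction from [j] to [j']; the first two steps are all that is
    recorded.  In [chain_left] the same run is followed to the left. *)
Lemma chain_right : i < i' -> 0 < i -> 0 < j < n.+1 -> boundary n.+1 i' j' ->
  chain n.+1 (entry tau i) (entry tau i.+1) (i.+1 == n.+1) j.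
Proof.
move=> i_lt i_gt0 j_int bd; have i'_lt := ltn_ord i'; have j'_lt := ltn_ord j'.
have jE : val j = bump j' (entry tau i).
  by apply: entry_at_i; rewrite /= /bump; lia.
case: (eqVneq i.+1 i') => [adj|far].
  have : val j' = bump j (entry tau i).
    by apply: entry_at_i'; rewrite /= /bump; lia.
  by move: jE bd; rewrite /boundary /chain /bump /=; lia.
have shift : bump j (entry tau i) = bump j' (entry tau i.+1).
  by apply: entry_shift; rewrite /bump; lia.
have ne : entry tau i != entry tau i.+1.
  by apply/eqP => /entry_inj; lia.
by move: jE shift ne; rewrite /chain /bump /=; lia.
Qed.

Lemma chain_left : i' < i -> i < n.+1 -> 0 < j < n.+1 -> boundary n.+1 i' j' ->
  chain n.+1 (entry tau i.-1) (entry tau i.-2) (i == 1 :> nat) j.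
Proof.
move=> i_lt i_lt_n j_int bd; have j'_lt := ltn_ord j'.
have jE : val j = bump j' (entry tau i.-1).
  by apply: entry_at_i; rewrite /= /bump; lia.
case: (eqVneq i.-1 i') => [adj|far].
  have : val j' = bump j (entry tau i.-1).
    by apply: entry_at_i'; rewrite /= /bump; lia.
  by move: jE bd; rewrite /boundary /chain /bump /=; lia.
have shift : bump j (entry tau i.-1) = bump j' (entry tau i.-2).
  by apply: entry_shift; rewrite /bump; lia.
have ne : entry tau i.-1 != entry tau i.-2.
  by apply/eqP => /entry_inj; lia.
by move: jE shift ne; rewrite /chain /bump /=; lia.
Qed.

End EqualInsertions.

(** * Shaded columns *)

(** The part of a coincidence that concerns columns only: applied to the
    inverse permutation, it serves for rows. *)
Definition border_escapes (n : nat) (tau : 'S_n.+1) (X : pred nat) : Prop :=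
  forall i j : 'I_n.+2, boundary n.+1 i j ->
    exists i' j' : 'I_n.+2, ~~ X i' /\ lift_perm i j tau = lift_perm i' j' tau.

(** The insertion of a new extreme value in column [x] can be made in another
    column only next to the old extreme value of [tau], at position [p]. *)
Lemma tied_column_touches_extremes (n : nat) (tau : 'S_n.+1) (X : pred nat) :
  border_escapes tau X ->
  forall (x : nat) (p : 'I_n.+1), 0 < n -> 0 < x < n.+1 -> X x ->
  (tau p == 0 :> nat) || (tau p == n :> nat) -> (p == x :> nat) || (p.+1 == x).
Proof.
move=> escape x p n_gt0 x_int Xx p_ext.
pose i : 'I_n.+2 := inord x.
pose j : 'I_n.+2 := inord (if tau p == 0 :> nat then 0 else n.+1).
have iE : i = x :> nat by rewrite inordK //; lia.
have jE : j = (if tau p == 0 :> nat then 0 else n.+1) :> nat.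
  by rewrite inordK //; case: ifP.
have [|i' [j' [X'i' eq_lift]]] := escape i j.
  by rewrite /boundary jE; case: ifP; rewrite ?eqxx ?orbT.
have ii' : i != i' by apply: contraNneq X'i' => <-; rewrite iE.
have [a + [a_lt]] := equal_insertion_touches eq_lift ii'.
have := entry_ltn tau a; rewrite iE jE => t_lt a_x t_j.
suff <- : a = p by [].
apply: (entry_inj (s := tau)) => //; rewrite /entry inord_val -/(entry tau a).
by case: ifP t_j; lia.
Qed.

(** Both neighbours of such a column are extreme, so its index is the larger
    of the positions of the two extreme values. *)
Lemma tied_column_unique (n : nat) (tau : 'S_n.+1) (X : pred nat) :
  border_escapes tau X ->
  0 < n -> exists y, forall x, 0 < x < n.+1 -> X x -> x = y.
Proof.
move=> escape n_gt0.
pose p := (tau^-1)%g ord0; pose q := (tau^-1)%g ord_max.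
have pq : p != q :> nat by rewrite val_eqE (inj_eq perm_inj) -val_eqE /=; lia.
exists (maxn p q) => x x_int Xx.
have touches := tied_column_touches_extremes escape n_gt0 x_int Xx.
have := touches p; have := touches q; rewrite !permKV /= !eqxx orbT.
by move=> /(_ isT) + /(_ isT); lia.
Qed.

(** * Columns beside an extreme entry *)

(** [e] is the extreme entry on one side of the column, [v] the entry on the
    other side, and [y] the only row that may be shaded.  The four rows 1, 2,
    3, 4 are then covered by [y], [v], [v + 1] and the one interior row [f]
    touching [e], so these are distinct; the runs for the rows [v] and [v + 1]
    would continue to [w = v + 1] and to [w = v - 1] respectively, so that
    there is no entry [w]. *)
Lemma column_beside_extreme (k e v w y : nat) (last : bool) :
  4 < k -> (e == 0) || (e.+1 == k) -> v < k -> v != e ->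
  (forall j, 0 < j < k -> j != y ->
     [|| e == j, e.+1 == j | chain k v w last j]) ->
  last.
Proof.
move=> k_gt4 e_ext v_lt ve cover.
pose f := if e == 0 then 1 else e.
have near j : 0 < j < k -> [|| j == y, j == f, j == v | j == v.+1].
  move=> j_int; have [//|jy] := eqVneq j y.
  by have := cover j j_int jy; rewrite /f /chain; case: ifP; lia.
have n1 := near 1 ltac:(lia); have n2 := near 2 ltac:(lia).
have n3 := near 3 ltac:(lia); have n4 := near 4 ltac:(lia).
have [v_int [v_y [vS_y [v_f vS_f]]]] : 0 < v < 4 /\ v != y /\ v.+1 != y /\ v != f /\ v.+1 != f.
  lia.
have v_lo : 0 < v < k by lia.
have v_hi : 0 < v.+1 < k by lia.
have := cover v v_lo v_y; have := cover v.+1 v_hi vS_y.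
move: v_f vS_f; rewrite /f /chain; case: ifP; case: last {cover near} => //=; lia.
Qed.

(** * Bounding the length *)

(** The conclusion for the grid alone: the border cells and the unshaded cells
    can give the same insertions only in short permutations.  Of the rows,
    only the fact that at most one of them is shaded enters. *)
Lemma no_balanced_shading (n : nat) (tau : 'S_n.+1) (X Y : pred nat) :
    (forall i j : 'I_n.+2, boundary n.+1 i j -> exists i' j' : 'I_n.+2,
       ~~ X i' && ~~ Y j' /\ lift_perm i j tau = lift_perm i' j' tau) ->
    (forall i j : 'I_n.+2, ~~ X i && ~~ Y j -> exists i' j' : 'I_n.+2,
       boundary n.+1 i' j' /\ lift_perm i j tau = lift_perm i' j' tau) ->
  n < 4.
Proof.
move=> bd_free free_bd; rewrite ltnNge; apply/negP => n_ge4.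
have n_gt0 : 0 < n by lia.
have escX : border_escapes tau X.
  by move=> i j /bd_free[i' [j' [/andP[Xi' _] eq_lift]]]; exists i', j'.
(* Inverting a permutation exchanges rows and columns. *)
have escY : border_escapes tau^-1 Y.
  move=> j i bd; have [|i' [j' [/andP[_ Yj'] eq_lift]]] := bd_free i j.
    by move: bd; rewrite /boundary; lia.
  by exists j', i'; rewrite -!lift_permV eq_lift.
have [y Y_uniq] := tied_column_unique escY n_gt0.
have column (i : nat) : 0 < i < n.+1 -> ~~ X i -> forall j, 0 < j < n.+1 -> j != y ->
     chain n.+1 (entry tau i) (entry tau i.+1) (i.+1 == n.+1) j
  || chain n.+1 (entry tau i.-1) (entry tau i.-2) (i == 1) j.
  move=> i_int Xi j j_int jy.
  pose i0 : 'I_n.+2 := inord i; pose j0 : 'I_n.+2 := inord j.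
  have iE : i0 = i :> nat by rewrite inordK //; lia.
  have jE : j0 = j :> nat by rewrite inordK //; lia.
  have [|i' [j' [bd eq_lift]]] := free_bd i0 j0.
    rewrite iE jE Xi /=; apply/negP => Yj; move: jy.
    by rewrite (Y_uniq j) ?eqxx.
  case: (ltngtP i0 i') => [lt|gt|/val_inj eq_i].
  - apply/orP; left; rewrite -iE -jE.
    by apply: (chain_right eq_lift lt _ _ bd); lia.
  - apply/orP; right; rewrite -iE -jE.
    by apply: (chain_left eq_lift gt _ _ bd); lia.
  - have eq_j : j0 = j'.
      by rewrite -(lift_perm_id i0 j0 tau) eq_lift eq_i lift_perm_id.
    by move: bd; rewrite -eq_i -eq_j /boundary; lia.
(* An extreme entry lies beside the column, so no run starts on its side at
   the rows that do not touch it. *)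
have beside (p : 'I_n.+1) : (tau p == 0 :> nat) || (tau p == n :> nat) ->
    (p < n -> ~~ X p.+1 -> p.+1 = n) /\ (0 < p -> ~~ X p -> val p = 1).
  have p_lt := ltn_ord p; rewrite -[tau p](congr1 tau (inord_val p)) -/(entry tau p).
  move=> p_ext; split=> [p_lt_n|p_gt0] Xp.
  - have cov := @column p.+1 ltac:(lia) Xp.
    apply/eqP; rewrite -eqSS.
    apply: (@column_beside_extreme n.+1 (entry tau p) (entry tau p.+1) (entry tau p.+2) y).
    + by [].
    + by rewrite eqSS.
    + exact: entry_ltn.
    + by apply/eqP => /entry_inj; lia.
    + move=> j j_int jy; have /orP[->|] := cov j j_int jy; first by rewrite !orbT.
      by rewrite /chain /=; lia.
  - have cov := @column p ltac:(lia) Xp.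
    apply/eqP.
    apply: (@column_beside_extreme n.+1 (entry tau p) (entry tau p.-1) (entry tau p.-2) y).
    + by [].
    + by rewrite eqSS.
    + exact: entry_ltn.
    + by apply/eqP => /entry_inj; lia.
    + move=> j j_int jy; have /orP[|->] := cov j j_int jy; last by rewrite !orbT.
      by rewrite /chain /=; lia.
pose p := (tau^-1)%g ord0; pose q := (tau^-1)%g ord_max.
have p_ext : (tau p == 0 :> nat) || (tau p == n :> nat) by rewrite permKV.
have q_ext : (tau q == 0 :> nat) || (tau q == n :> nat) by rewrite permKV eqxx orbT.
have pq : p != q :> nat by rewrite val_eqE (inj_eq perm_inj) -val_eqE /=; lia.
have [p_right p_left] := beside p p_ext.
have [q_right q_left] := beside q q_ext.
have touches (r : 'I_n.+1) x (x_int : 0 < x < n.+1) (Xx : X x) :=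
  tied_column_touches_extremes escX (p := r) n_gt0 x_int Xx.
have p_lt := ltn_ord p; have q_lt := ltn_ord q.
have Xp : 0 < p -> X p -> q.+1 = p.
  by move=> p_gt0 /(touches q _)/(_ q_ext); lia.
have XSp : p < n -> X p.+1 -> val q = p.+1.
  by move=> p_lt_n /(touches q _)/(_ q_ext) /=; lia.
have Xq : 0 < q -> X q -> p.+1 = q.
  by move=> q_gt0 /(touches p _)/(_ p_ext); lia.
have XSq : q < n -> X q.+1 -> val p = q.+1.
  by move=> q_lt_n /(touches p _)/(_ p_ext) /=; lia.
move: p_right p_left q_right q_left Xp XSp Xq XSq => /=.
case: (X p) (X p.+1) (X q) (X q.+1) => [] [] [] [] /=; lia.
Qed.

Theorem theorem5p4 :
  (forall (k : nat) (tau : 'S_k) (B : bivincular k),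
     coincident (Box tau) (Biv B) -> k <= 4) /\
  ~ (forall N : nat, exists (k : nat) (tau : 'S_k) (B : bivincular k),
       N <= k /\ coincident (Box tau) (Biv B)).
Proof.
have bound (k : nat) (tau : 'S_k) (B : bivincular k) :
    coincident (Box tau) (Biv B) -> k <= 4.
  case: k tau B => [|[|n]] // tau B coin.
  have sigmaE := coincident_perm coin.
  have same := coincident_contains coin (n := n.+3).
  apply: (@no_balanced_shading n.+1 tau (separates (bv_X B)) (separates (bv_Y B))).
  - move=> i j bd; rewrite -sigmaE; apply/contains_Biv; rewrite -same sigmaE.
    by apply/contains_Box => //; exists i, j.
  - move=> i j free; apply/contains_Box => //; rewrite same -sigmaE.
    by apply/contains_Biv; exists i, j.
split=> // /(_ 5)[k [tau [B [k_ge5 /bound]]]].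
by rewrite leqNgt k_ge5.
Qed.
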